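(* There is a $64\,T\to1\,\mathbb F_4$-$CCZ$ distillation protocol at distance $4$. Precisely, let $\mathcal D\subset\mathbb F_{16}^2$ be the set of points $(x,y)$ with $y^4+y=x^5$ (so $|\mathcal D|=64$), let $\mathbb F_{16}=\mathbb F_2(\alpha)$ with $\alpha^4=\alpha+1$, and let $(\beta_1,\beta_2,\beta_3,\beta_4)=(\alpha^3,\alpha^{12},\alpha^7,\alpha^{13})$, a self-dual basis of $\mathbb F_{16}$ over $\mathbb F_2$. Let $G$ be the binary matrix with columns indexed by $\mathcal D$ whose six logical rows are the evaluations on $\mathcal D$ of $$\mathrm{tr}(\beta_3x^3),\ \mathrm{tr}(\beta_4x^3),\ \mathrm{tr}(\beta_1xy),\ \mathrm{tr}(\beta_2xy),\ \mathrm{tr}(\beta_3xy),\ \mathrm{tr}(\beta_4xy),$$ and whose nine stabilizer rows are the evaluations of $1$, $\mathrm{tr}(\beta_ix)$ and $\mathrm{tr}(\beta_iy)$, $1\le i\le4$. Then $G$ has full rank; the $Z$-distance of the corresponding CSS code is $4$; and $D_G=C\,(V\otimes I)$ for some diagonal Clifford unitary $C$ on $15$ qubits, where $V$ is, up to a permutation of the six logical qubits, the $\mathbb F_4$-qudit $CCZ$ gate.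
   Context: $T=\mathrm{diag}(1,e^{i\pi/4})$; $\mathrm{tr}$ applied to elements of $\mathbb F_{16}$ is the trace $\mathbb F_{16}\to\mathbb F_2$. The $\mathbb F_4$-qudit $CCZ$ gate is $|x\rangle|y\rangle|z\rangle\mapsto(-1)^{\mathrm{tr}_{\mathbb F_4/\mathbb F_2}(xyz)}|x\rangle|y\rangle|z\rangle$ for $x,y,z\in\mathbb F_4=\{0,1,\omega,\omega^2\}$ ($\omega^2=\omega+1$), viewed as a six-qubit gate by writing $x=x_1\omega+x_2\omega^2$, and similarly for $y,z$; it is the product of $CCZ$ gates with phase polynomial $x_1(y_1z_2+y_2z_1+y_2z_2)+x_2(y_1z_1+y_1z_2+y_2z_1)$. A full-rank binary matrix $G\in\mathbb F_2^{m\times n}$ with $k$ logical rows defines a CSS code on $n$ qubits: the first $k$ rows are $X$-logical operators, the last $m-k$ rows are $X$-stabilizer generators. Its $Z$-distance is the minimum Hamming weight of a vector in $\mathbb F_2^n$ orthogonal to all stabilizer rows but not to at least one logical row. The unitary on $m$ qubits (one per row) induced by applying $T$ to every physical qubit is $D_G|z\rangle=\exp\!\big(\tfrac{i\pi}{4}\mathrm{wt}(\sum_az_a\mathbf g_a)\big)|z\rangle$, $z\in\mathbb F_2^m$, with $\mathrm{wt}$ the Hamming weight and the row sum taken mod 2. *)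

(* Defs.v *)
From mathcomp Require Import all_boot all_order all_fingroup all_algebra all_solvable all_field.
From mathcomp Require Import spectral complex.
From mathcomp Require Import reals trigo.

Set Implicit Arguments.
Unset Strict Implicit.
Unset Printing Implicit Defensive.

Import Order.TTheory GRing.Theory Num.Theory.
Local Open Scope ring_scope.
Local Open Scope sesquilinear_scope.

(* The trace F -> F_2 of a field F with 2 ^ n elements is
   x + x^2 + ... + x^(2^(n-1)), an element of the prime field {0, 1} of F;
   lemma traceF2E relates it to the trace of Galois theory. *)
Definition traceF2 (F : finFieldType) (x : F) : 'F_2 :=
  (\sum_(i < logn 2 #|F|) x ^+ (2 ^ i) != 0)%:R.

Lemma traceF2E (F : finFieldType) (charF : 2%N \in [pchar F])
    (x : pPrimeCharType charF) :
  galTrace 1 {:pPrimeCharType charF} x = (traceF2 (x : F))%:A.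
Proof.
have galL : galois 1 {:pPrimeCharType charF} by apply/finField_galois/sub1v.
have [a /eqP defG aE] := finField_galois_generator (sub1v {:pPrimeCharType charF}).
have ordG : #[a]%g = logn 2 #|F|.
  by rewrite orderE -defG -galois_dim // dimv1 divn1 pprimeChar_dimf.
have aXE i : (a ^+ i)%g x = x ^+ (2 ^ i).
  elim: i => [|i IHi]; first by rewrite expg0 gal_id expr1.
  rewrite expgSr galM ?memvf // IHi rmorphXn /= aE ?memvf //.
  by rewrite dimv1 expn1 card_Fp // -exprM -expnS.
have trE : galTrace 1 {:pPrimeCharType charF} x =
    \sum_(i < logn 2 #|F|) x ^+ (2 ^ i).
  rewrite /galTrace defG -ordG.
  rewrite (reindex (fun i : 'I_#[a]%g => (a ^+ i)%g)) /=; last first.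
    exists (fun y => if [pick i : 'I_#[a]%g | (a ^+ i)%g == y] is Some i
      then i else Ordinal (order_gt0 a)) => [i _|y].
      case: pickP => [j|/(_ i)]; last by rewrite eqxx.
      by rewrite eq_expg_ord => // /eqP.
    case/cyclePmin=> i lt_i ->; case: pickP => [j /eqP//|/(_ (Ordinal lt_i))].
    by rewrite eqxx.
  by apply: eq_big => [i|i _]; rewrite ?mem_cycle ?aXE.
have /vlineP[c trc] : galTrace 1 {:pPrimeCharType charF} x \in 1%VS.
  by rewrite mem_galTrace ?memvf.
have -> : traceF2 (x : F) = (c != 0)%:R.
  congr (nat_of_bool (~~ _))%:R; rewrite -[LHS]/(_ == 0 :> pPrimeCharType charF).
  by rewrite -trE trc scaler_eq0 oner_eq0 orbF.
rewrite trc; congr (_%:A); apply: val_inj.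
by case: c {trc} => [[|[|c]]].
Qed.

Definition wt (n : nat) (v : 'rV['F_2]_n) : nat := #|[set j | v 0 j != 0]|.

(* In G : 'M_(k + s, n) the first k rows are the X-logical operators and the
   last s rows are the X-stabilizer generators. *)
Definition Zlogical (k s n : nat) (G : 'M['F_2]_(k + s, n)) (v : 'rV['F_2]_n) :=
  (dsubmx G *m v^T == 0) && (usubmx G *m v^T != 0).

Definition Zdistance_is (k s n : nat) (G : 'M['F_2]_(k + s, n)) (d : nat) :=
  (exists2 v, Zlogical G v & wt v = d) /\
  (forall v, Zlogical G v -> (d <= wt v)%N).

(* The computational basis of n qubits is indexed by 'rV['F_2]_n, enumerated by
   enum_val; in all matrices below the column index is the input basis state. *)
Definition operator (C : numClosedFieldType) (n : nat) :=
  'M[C]_#|{: 'rV['F_2]_n}|.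

Section Operators.

Variable C : numClosedFieldType.

Definition opmx (n : nat) (f : 'rV['F_2]_n -> 'rV['F_2]_n -> C) : operator C n :=
  \matrix_(i, j) f (enum_val i) (enum_val j).

Definition diagop (n : nat) (f : 'rV['F_2]_n -> C) : operator C n :=
  diag_mx (\row_i f (enum_val i)).

Definition tensop (m n : nat) (A : operator C m) (B : operator C n) :
    operator C (m + n) :=
  opmx (fun y z => A (enum_rank (lsubmx y)) (enum_rank (lsubmx z)) *
                   B (enum_rank (rsubmx y)) (enum_rank (rsubmx z))).

Definition pauliX (n : nat) (a : 'rV['F_2]_n) : operator C n :=
  opmx (fun y z => (y == z + a)%:R).

Definition pauliZ (n : nat) (b : 'rV['F_2]_n) : operator C n :=
  diagop (fun z => (-1) ^+ ((b *m z^T) 0 0 : 'F_2)).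

Definition is_pauli (n : nat) (P : operator C n) : Prop :=
  exists (k : nat) (a b : 'rV['F_2]_n), P = 'i ^+ k *: (pauliX a *m pauliZ b).

Definition is_clifford (n : nat) (U : operator C n) : Prop :=
  U \is unitarymx /\ (forall P, is_pauli P -> is_pauli (U *m P *m U^t*)).

Definition qubit_perm (n : nat) (s : 'S_n) : operator C n :=
  opmx (fun y z => (y == col_perm s z)%:R).

(* The six qubits are x_1, x_2, y_1, y_2, z_1, z_2 in this order. *)
Definition F4_CCZ (F4 : finFieldType) (omega : F4) : operator C 6 :=
  let elt (q : 'rV['F_2]_6) (i : 'I_3) : F4 :=
    (q 0 (inord i.*2))%:R * omega + (q 0 (inord i.*2.+1))%:R * omega ^+ 2 in
  diagop (fun q => (-1) ^+ traceF2 (elt q 0 * elt q 1 * elt q 2)).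

End Operators.

Definition expi (R : realType) (t : R) : R[i] := (cos t +i* sin t)%C.

(* z *m G is the sum of the rows of G weighted by z, taken in F_2. *)
Definition T_induced (R : realType) (m n : nat) (G : 'M['F_2]_(m, n)) :
    operator R[i] m :=
  diagop (fun z => expi (pi / 4 * (wt (z *m G))%:R)).

Section HermitianCode.

Variables (F : finFieldType) (alpha : F).

Definition points : {set F * F} := [set p | p.2 ^+ 4 + p.2 == p.1 ^+ 5].

Definition beta : 4.-tuple F :=
  [tuple alpha ^+ 3; alpha ^+ 12; alpha ^+ 7; alpha ^+ 13].

(* Indices start at 0: tr_beta i u is tr(beta_(i+1) u). *)
Definition tr_beta (i : nat) (u : F) : 'F_2 := traceF2 (beta`_i * u).

Definition logical_fun : 6.-tuple (F * F -> 'F_2) :=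
  [tuple fun p => tr_beta 2 (p.1 ^+ 3);
         fun p => tr_beta 3 (p.1 ^+ 3);
         fun p => tr_beta 0 (p.1 * p.2);
         fun p => tr_beta 1 (p.1 * p.2);
         fun p => tr_beta 2 (p.1 * p.2);
         fun p => tr_beta 3 (p.1 * p.2)].

Definition stabilizer_fun : 9.-tuple (F * F -> 'F_2) :=
  [tuple fun p => 1;
         fun p => tr_beta 0 p.1; fun p => tr_beta 1 p.1;
         fun p => tr_beta 2 p.1; fun p => tr_beta 3 p.1;
         fun p => tr_beta 0 p.2; fun p => tr_beta 1 p.2;
         fun p => tr_beta 2 p.2; fun p => tr_beta 3 p.2].

(* Column j is indexed by the point enum_val j. *)
Definition hermitian_mx : 'M['F_2]_(6 + 9, #|points|) :=
  col_mx (\matrix_(i, j) tnth logical_fun i (enum_val j))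
         (\matrix_(i, j) tnth stabilizer_fun i (enum_val j)).

End HermitianCode.

Definition self_dual_basis (F : finFieldType) (n : nat) (b : n.-tuple F) : Prop :=
  (forall x : F, exists! c : 'rV['F_2]_n, x = \sum_(i < n) (c 0 i)%:R * tnth b i)
  /\ (forall i j, traceF2 (tnth b i * tnth b j) = (i == j)%:R).

(* Main.v *)
Require Import Defs.
From mathcomp Require Import all_boot all_order all_fingroup all_algebra all_solvable all_field.
From mathcomp Require Import spectral complex.
From mathcomp Require Import reals trigo.
From mathcomp Require Import ring.

Set Implicit Arguments.
Unset Strict Implicit.
Unset Printing Implicit Defensive.

Import Order.TTheory GRing.Theory Num.Theory.
Local Open Scope ring_scope.
Local Open Scope sesquilinear_scope.

(** Expanding wt (u + v) = wt u + wt v - 2 wt (u v) shows that the phase of T on all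
    qubits is the exponential of a cubic form: modulo diagonal Clifford gates only the
    triple overlaps of rows, taken mod 2, matter, provided all pairwise overlaps are even.
    Up to exchanging y_1 and y_2, the triple overlaps of the Hermitian matrix are the
    coefficients of the trace of xyz on F_4, so dividing by the corresponding CCZ phase
    leaves a quadratic phase, that is, a Clifford gate.  For the distance: the row 1 makes
    Z-logical weights even, and weight 2 is impossible because the rows tr(beta_i x),
    tr(beta_i y) separate points.  The finite verifications are evaluated on explicit bit
    codes of F_16 and F_4. *)

(** * Characteristic 2 and additivity of the trace *)

Lemma pchar2_card2X (F : finFieldType) n :
  #|F| = (2 ^ n.+1)%N -> 2%N \in [pchar F].
Proof.
move=> cF; have [p p_pr pF] := finPcharP F.
have cFp : #|F| = (p ^ logn p #|F|)%N by rewrite {1}(card_pprimeChar pF).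
have : (p %| 2 ^ n.+1)%N.
  have [k0|k_gt0] := posnP (logn p #|F|); last by rewrite -cF cFp dvdn_exp.
  by have := finNzRing_gt1 F; rewrite cFp k0.
by rewrite Euclid_dvdX // andbT dvdn_prime2 // => /eqP <-.
Qed.

(** The test against 0 in [traceF2] hides additivity; it is inherited from the Galois trace through
    the injection of F_2 into the field. *)
Lemma traceF2D (F : finFieldType) (charF : 2%N \in [pchar F]) :
  {morph @traceF2 F : x y / x + y}.
Proof.
move=> x y; apply: (@fmorph_inj _ _ (in_alg (pPrimeCharType charF))).
by rewrite rmorphD /= -!traceF2E [LHS]raddfD.
Qed.

(** * Bit codes for finite fields of characteristic 2 *)

(* The element sum_i s_i a^i of GF(2^n) = F_2(a) is coded by the bits s_0, ..., s_(n-1);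
   red is the code of a^n. *)
Fixpoint bits_add (s t : bitseq) : bitseq :=
  match s, t with
  | [::], _ => t
  | _, [::] => s
  | b :: s', c :: t' => (b (+) c) :: bits_add s' t'
  end.

(** Multiplication by [a]: after the shift, a set bit of degree n is traded for [red]. *)
Definition bits_xtime n (red s : bitseq) : bitseq :=
  let t := false :: s in
  bits_add (take n t) (if nth false t n then red else [::]).

Definition bits_mul n red (s t : bitseq) : bitseq :=
  foldr (fun b r => bits_add (if b then t else [::]) (bits_xtime n red r))
        (nseq n false) s.

Definition bits_one n : bitseq := true :: nseq n.-1 false.

Definition bits_exp n red (s : bitseq) k : bitseq :=
  iter k (bits_mul n red s) (bits_one n).

Definition bits_trace n red (s : bitseq) : bool :=
  has id (foldr bits_add (nseq n false)
                [seq bits_exp n red s (2 ^ i) | i <- iota 0 n]).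

Fixpoint bits n : seq bitseq :=
  if n is n'.+1 then [seq b :: s | b <- [:: false; true], s <- bits n']
  else [:: [::]].

(* The inverses of all nonzero codes make the evaluation of codes injective. *)
Definition bits_field n red : bool :=
  [&& (0 < n)%N, size red == n &
   all (fun s => has id s ==>
                 has (fun t => bits_mul n red s t == bits_one n) (bits n))
       (bits n)].

Lemma mem_bits n s : (s \in bits n) = (size s == n).
Proof.
elim: n s => [|n IHn] [|b s] //=; rewrite cats0 mem_cat.
  by apply/negP=> /orP[] /mapP[].
rewrite eqSS -IHn; have inj_b c : injective (cons c : bitseq -> _) by move=> ? ? [].
case: b; rewrite (mem_map (inj_b _)) ?orbF //=.
  by case: mapP => // -[].
by case: (boolP (s \in _)) => //= _; apply/mapP=> -[].
Qed.

Lemma size_bits n : size (bits n) = (2 ^ n)%N.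
Proof. by elim: n => //= n IHn; rewrite !size_cat !size_map IHn addn0 expnS mul2n addnn. Qed.

Lemma uniq_bits n : uniq (bits n).
Proof.
elim: n => //= n IHn; have inj_b c : injective (cons c : bitseq -> _) by move=> ? ? [].
rewrite cats0 cat_uniq !map_inj_uniq // IHn andbT /=.
by apply/hasPn=> _ /mapP[s _ ->]; apply/mapP=> -[].
Qed.

Lemma size_bits_add s t : size (bits_add s t) = maxn (size s) (size t).
Proof. by elim: s t => [|b s IHs] [|c t] //=; rewrite ?IHs ?maxnSS ?max0n ?maxn0. Qed.

(** * Evaluation of bit codes in the field *)

Section BitsField.

Variables (F : finFieldType) (n : nat) (red : bitseq) (a : F).

Fixpoint bits_eval (s : bitseq) : F :=
  if s is b :: s' then b%:R + a * bits_eval s' else 0.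

Lemma bits_eval_nseq0 k : bits_eval (nseq k false) = 0.
Proof. by elim: k => //= k ->; rewrite mulr0 addr0. Qed.

Lemma bits_eval_cat s t :
  bits_eval (s ++ t) = bits_eval s + a ^+ size s * bits_eval t.
Proof.
elim: s => [|b s IHs] /=; first by rewrite add0r mul1r.
by rewrite IHs exprS mulrDr mulrA addrA.
Qed.

Hypotheses (bitsF : bits_field n red) (cardF : #|F| = (2 ^ n)%N).
Hypothesis aE : a ^+ n = bits_eval red.

Let n_gt0 : (0 < n)%N. Proof. by case/and3P: bitsF. Qed.
Let size_red : size red = n. Proof. by case/and3P: bitsF => _ /eqP. Qed.

Lemma bits_pchar : 2%N \in [pchar F].
Proof. by apply: (@pchar2_card2X _ n.-1); rewrite prednK. Qed.

Lemma bits_eval_one : bits_eval (bits_one n) = 1.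
Proof. by rewrite /= bits_eval_nseq0 mulr0 addr0. Qed.

Lemma size_bits_one : size (bits_one n) = n.
Proof. by rewrite /= size_nseq prednK. Qed.

Lemma bits_eval_add s t : bits_eval (bits_add s t) = bits_eval s + bits_eval t.
Proof.
elim: s t => [|b s IHs] [|c t] //=; rewrite ?add0r ?addr0 // IHs mulrDr addrACA.
congr (_ + _); case: b c => [] [] /=; rewrite ?addr0 ?add0r //.
by rewrite addrr_pchar2 ?bits_pchar.
Qed.

Lemma size_bits_xtime s : size s = n -> size (bits_xtime n red s) = n.
Proof.
move=> sz; rewrite size_bits_add size_take /= sz ltnS leqnn.
by apply/maxn_idPl; case: ifP => _ //; rewrite size_red.
Qed.

Lemma bits_eval_xtime s : size s = n -> bits_eval (bits_xtime n red s) = a * bits_eval s.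
Proof.
move=> sz; have -> : a * bits_eval s = bits_eval (false :: s) by rewrite /= add0r.
(* The shifted code splits at degree n into its low part and a single top bit, and [a ^+ n] is the
   value of [red]. *)
rewrite -[X in _ = bits_eval X](cat_take_drop n) bits_eval_cat bits_eval_add.
rewrite (drop_nth false) /= ?sz // drop_oversize /= ?sz //.
rewrite size_take /= sz ltnS leqnn mulr0 addr0 aE; congr (_ + _).
by case: (nth _ _ _); rewrite ?mulr1 ?mulr0.
Qed.

Lemma size_bits_mul s t : size t = n -> size (bits_mul n red s t) = n.
Proof.
move=> sz; elim: s => [|b s IHs] /=; first by rewrite size_nseq.
by rewrite size_bits_add size_bits_xtime //; case: b; rewrite /= ?sz ?maxnn ?max0n.
Qed.

Lemma bits_eval_mul s t :
  size t = n -> bits_eval (bits_mul n red s t) = bits_eval s * bits_eval t.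
Proof.
move=> sz; elim: s => [|b s IHs] /=; first by rewrite bits_eval_nseq0 mul0r.
rewrite bits_eval_add bits_eval_xtime ?size_bits_mul // IHs mulrDl mulrA.
by case: b; rewrite /= ?mul1r ?mul0r.
Qed.

Lemma size_bits_exp s k : size (bits_exp n red s k) = n.
Proof. by elim: k => [|k IHk]; [exact: size_bits_one | exact: size_bits_mul]. Qed.

Lemma bits_eval_exp s k : bits_eval (bits_exp n red s k) = bits_eval s ^+ k.
Proof.
elim: k => [|k IHk]; first exact: bits_eval_one.
by rewrite exprS -IHk /= bits_eval_mul ?size_bits_exp.
Qed.

(** By [bits_field] a nonzero code has an inverse code, so its value is a unit. *)
Lemma bits_eval_eq0 s : size s = n -> (bits_eval s == 0) = ~~ has id s.
Proof.
move=> sz; apply/idP/idP; last first.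
  rewrite -all_predC => /all_nthP s0; rewrite -(bits_eval_nseq0 n) -sz; apply/eqP.
  congr bits_eval; apply: (@eq_from_nth _ false); rewrite ?size_nseq // => i lti.
  by rewrite nth_nseq lti; apply/negbTE/s0.
apply: contraTN => s_neq0.
have /and3P[_ _ /allP/(_ s)] := bitsF; rewrite mem_bits sz eqxx s_neq0 => /(_ isT).
move=> /hasP[t]; rewrite mem_bits => /eqP szt /eqP mul1.
apply/eqP=> s0; have := oner_neq0 F.
by rewrite -bits_eval_one -mul1 bits_eval_mul // s0 mul0r eqxx.
Qed.

(** In characteristic 2 the sum of two codes evaluates to the difference of their values. *)
Lemma bits_eval_inj s t : size s = n -> size t = n -> bits_eval s = bits_eval t -> s = t.
Proof.
move=> szs szt eq_st.
have : bits_eval (bits_add s t) == 0.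
  by rewrite bits_eval_add eq_st addrr_pchar2 ?bits_pchar.
rewrite bits_eval_eq0 ?size_bits_add ?szs ?szt ?maxnn // => {eq_st}.
have: size s = size t by rewrite szs.
elim: s t {szs szt} => [|b s IHs] [|c t] //= [/IHs{}IHs].
by rewrite negb_or => /andP[+ /IHs ->]; case: b c => [] [].
Qed.

(** Counting: the 2^n codes take distinct values in a field with 2^n elements. *)
Lemma bits_eval_surj x : exists2 s, s \in bits n & x = bits_eval s.
Proof.
apply/mapP; have uniqE : uniq [seq bits_eval s | s <- bits n].
  rewrite map_inj_in_uniq ?uniq_bits // => s t.
  by rewrite !mem_bits => /eqP + /eqP; apply: bits_eval_inj.
have sub : {subset [seq bits_eval s | s <- bits n] <= enum F} by move=> y; rewrite mem_enum.
have [|_ ->] := uniq_min_size uniqE sub; last by rewrite mem_enum.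
by rewrite -cardE size_map size_bits cardF.
Qed.

Lemma traceF2_bits_eval s : traceF2 (bits_eval s) = (bits_trace n red s)%:R.
Proof.
congr (nat_of_bool _)%:R; rewrite cardF pfactorK //.
rewrite -(big_mkord predT (fun i => bits_eval s ^+ (2 ^ i))) /index_iota subn0.
(* The length is carried along with the value, because the zero test applies to codes of length
   n. *)
have [sz <-] : let r := foldr bits_add (nseq n false)
    [seq bits_exp n red s (2 ^ i) | i <- iota 0 n] in
    size r = n /\ bits_eval r = \sum_(i <- iota 0 n) bits_eval s ^+ (2 ^ i).
  elim: (iota 0 n) => [|i r [szr IHr]] /=.
    by rewrite size_nseq bits_eval_nseq0 big_nil.
  by rewrite size_bits_add szr size_bits_exp maxnn big_cons bits_eval_add IHr bits_eval_exp.
by rewrite bits_eval_eq0 ?negbK.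
Qed.

End BitsField.

Definition F4_red := [:: true; true].
Definition F16_red := [:: true; true; false; false].

Lemma bits_field4 : bits_field 2 F4_red. Proof. by vm_compute. Qed.
Lemma bits_field16 : bits_field 4 F16_red. Proof. by vm_compute. Qed.

(** * Diagonal operators *)

Section DiagonalOperators.

Variable C : numClosedFieldType.

Lemma tensop_diagop1 m n (d : 'rV['F_2]_m -> C) :
  tensop (diagop d) (1%:M : operator C n) = diagop (fun z => d (lsubmx z)).
Proof.
apply/matrixP=> i j; rewrite !mxE !(inj_eq enum_rank_inj) enum_rankK.
rewrite -[i == j](inj_eq enum_val_inj); set y := enum_val i; set z := enum_val j.
have -> : (y == z) = (lsubmx y == lsubmx z) && (rsubmx y == rsubmx z).
  apply/eqP/andP=> [->//|[/eqP yzl /eqP yzr]].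
  by rewrite -[y]hsubmxK yzl yzr hsubmxK.
by do 2!case: (_ == _); rewrite ?mulr1n ?mulr1 ?mulr0.
Qed.

Lemma mul_diagop n (d e : 'rV['F_2]_n -> C) :
  diagop d *m diagop e = diagop (fun z => d z * e z).
Proof. by rewrite mulmx_diag; congr diag_mx; apply/rowP=> i; rewrite !mxE. Qed.

Lemma eq_diagop n (d e : 'rV['F_2]_n -> C) : d =1 e -> diagop d = diagop e.
Proof. by move=> de; congr diag_mx; apply/rowP=> i; rewrite !mxE de. Qed.

(** The permutation matrix sends the basis state z to [col_perm s z], so conjugation reads the
    diagonal at the preimage. *)
Lemma qubit_perm_diagop n (s : 'S_n) (d : 'rV['F_2]_n -> C) :
  qubit_perm C s *m diagop d *m (qubit_perm C s)^t* =
  diagop (fun z => d (col_perm s^-1 z)).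
Proof.
have spK (z : 'rV['F_2]_n) : col_perm s (col_perm s^-1 z) = z.
  by rewrite -col_permM mulgV col_perm1.
have spVK (z : 'rV['F_2]_n) : col_perm s^-1 (col_perm s z) = z.
  by rewrite -col_permM mulVg col_perm1.
rewrite mul_mx_diag; apply/matrixP=> i j; rewrite !mxE.
rewrite (bigD1 (enum_rank (col_perm s^-1 (enum_val i)))) //= big1 ?addr0; last first.
  move=> k; rewrite !mxE -(inj_eq enum_val_inj) enum_rankK => neq_k.
  case: eqP => [ik | _]; last by rewrite !mul0r.
  by rewrite ik spVK eqxx in neq_k.
rewrite !mxE enum_rankK spK eqxx mul1r (inj_eq enum_val_inj) conjC_nat mulr_natr.
by rewrite eq_sym.
Qed.

Lemma exprN1_F2D (x y : 'F_2) : (-1) ^+ (x + y)%R = (-1) ^+ x * (-1) ^+ y :> C.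
Proof. by rewrite -exprD -signr_odd -[RHS]signr_odd /= odd_mod ?oddD. Qed.

Lemma pauliE n (k : nat) (a b : 'rV['F_2]_n) :
  'i ^+ k *: (pauliX C a *m pauliZ C b) =
  opmx (fun y z => 'i ^+ k * ((y == z + a)%:R * (-1) ^+ ((b *m z^T) 0 0 : 'F_2))).
Proof. by rewrite mul_mx_diag; apply/matrixP=> i j; rewrite !mxE. Qed.

Lemma eq_opmx n (f g : 'rV['F_2]_n -> 'rV['F_2]_n -> C) :
  f =2 g -> opmx f = opmx g.
Proof. by move=> fg; apply/matrixP=> i j; rewrite !mxE. Qed.

Lemma diagop_conj_opmx n (c : 'rV['F_2]_n -> C) f :
  diagop c *m opmx f *m (diagop c)^t* = opmx (fun y z => c y * f y z * (c z)^*).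
Proof.
rewrite mul_diag_mx; apply/matrixP=> i j; rewrite !mxE (bigD1 j) //= big1 ?addr0.
  by rewrite !mxE eqxx mulr1n.
by move=> l neq_lj; rewrite !mxE [j == l]eq_sym (negbTE neq_lj) mulr0n rmorph0 mulr0.
Qed.

(* A diagonal gate maps X_a to c(a) X_a Z_b as soon as its phase function is
   quadratic: c(z + a) = c(z) c(a) (-1)^(b . z). *)
Lemma diagop_clifford n (c : 'rV['F_2]_n -> C) :
    (forall z, exists k, c z = 'i ^+ k) ->
    (forall a, exists b : 'rV['F_2]_n,
       forall z, c (z + a) = c z * c a * (-1) ^+ ((b *m z^T) 0 0 : 'F_2)) ->
  is_clifford (diagop c).
Proof.
move=> c_pow c_quad; have cK z : c z * (c z)^* = 1.
  have [k ->] := c_pow z; rewrite -normCK normrX normCi expr1n expr1n //.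
split=> [|_ [k [a [b ->]]]].
  apply/unitarymxP; rewrite mul_diag_mx; apply/matrixP=> i j; rewrite !mxE.
  have [->|_] := eqVneq j i; first by rewrite !mulr1n.
  by rewrite rmorph0 mulr0.
have [m cm] := c_pow a; have [b' cb'] := c_quad a.
(* The surviving entries have y = z + a and gain c(z + a) times the conjugate of c(z), which is c(a)
   (-1)^(b' . z): [c a = 'i ^+ m] joins the scalar and [b'] joins the Z part. *)
exists (k + m)%N, a, (b + b'); rewrite !pauliE diagop_conj_opmx; apply: eq_opmx => y z.
case: eqP => [->|_]; last by rewrite !mul0r !mulr0 mul0r.
rewrite cb' mulmxDl [(_ + _ : 'M_(1, 1)) 0 0]mxE exprN1_F2D exprD -cm !mul1r.
have combine (x x' u v s t : C) :
    x * x' = 1 -> x * u * s * (v * t) * x' = v * u * (t * s).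
  by move=> xx'; rewrite -[RHS]mulr1 -xx'; ring.
exact: combine.
Qed.

End DiagonalOperators.

(** * Phases of transversal T gates *)

Lemma F2_cases (x : 'F_2) : x = 0 \/ x = 1.
Proof. by case: x => [[|[|x]] //] x_lt; [left | right]; apply: val_inj. Qed.

Lemma natr_F2_eq0 n : (n%:R == 0 :> 'F_2) = ~~ odd n.
Proof. by rewrite -val_eqE /= val_Fp_nat // modn2; case: odd. Qed.

Lemma natr_F2_odd n : n%:R = (odd n)%:R :> 'F_2.
Proof. by apply: val_inj; rewrite /= !val_Fp_nat // !modn2 oddb. Qed.

(** Over F_2 the only scalars are 0 and 1, so additivity already gives linearity. *)
Lemma additive_F2_delta m (f : 'rV['F_2]_m -> 'F_2) :
  {morph f : u v / u + v} -> forall z, f z = \sum_i z 0 i * f (delta_mx 0 i).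
Proof.
move=> fD z; have f0 : f 0 = 0 by apply: (addrI (f 0)); rewrite -fD !addr0.
rewrite {1}[z]row_sum_delta (big_morph f fD f0); apply: eq_bigr => i _.
by case: (F2_cases (z 0 i)) => ->; rewrite ?scale0r ?scale1r ?mul0r ?mul1r.
Qed.

Lemma additive_F2_ext m (f g : 'rV['F_2]_m -> 'F_2) :
    {morph f : u v / u + v} -> {morph g : u v / u + v} ->
    (forall i, f (delta_mx 0 i) = g (delta_mx 0 i)) -> f =1 g.
Proof.
move=> fD gD fg z; rewrite (additive_F2_delta fD) (additive_F2_delta gD).
by apply: eq_bigr => i _; rewrite fg.
Qed.

Definition hadamard n (u v : 'rV['F_2]_n) : 'rV['F_2]_n := \row_j (u 0 j * v 0 j).

Lemma wt_sum n (v : 'rV['F_2]_n) : wt v = (\sum_j (v 0%R j != 0%R))%N.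
Proof. by rewrite /wt cardsE -sum1_card big_mkcond. Qed.

Lemma wtD n (u v : 'rV['F_2]_n) :
  (wt (u + v) + 2 * wt (hadamard u v) = wt u + wt v)%N.
Proof.
rewrite !wt_sum big_distrr -!big_split; apply: eq_bigr => j _ /=; rewrite !mxE.
by case: (F2_cases (u 0 j)) => ->; case: (F2_cases (v 0 j)) => ->.
Qed.

Lemma wt_natr n (v : 'rV['F_2]_n) : (wt v)%:R = \sum_j v 0 j.
Proof.
rewrite wt_sum natr_sum; apply: eq_bigr => j _.
by case: (F2_cases (v 0 j)) => ->.
Qed.

Lemma wt_even n (v : 'rV['F_2]_n) : \sum_j v 0 j = 0 -> wt v = (wt v)./2.*2.
Proof. by move/eqP; rewrite -wt_natr natr_F2_eq0 => /even_halfK. Qed.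

Section TGatePhases.

Variable R : realType.

Let zeta : R[i] := expi (pi / 4).

Lemma expiD (s t : R) : expi (s + t) = expi s * expi t.
Proof.
rewrite /expi cosD sinD; simpc; congr (_ +i* _)%C.
by rewrite addrC mulrC [X in _ + X]mulrC.
Qed.

Lemma expi_natr (t : R) k : expi (t * k%:R) = expi t ^+ k.
Proof.
elim: k => [|k IHk]; first by rewrite mulr0 expr0 /expi cos0 sin0.
by rewrite mulrS mulrDr mulr1 expiD IHk exprS.
Qed.

Lemma expi_pi4_2 : zeta ^+ 2 = 'i.
Proof.
rewrite -expi_natr; have -> : pi / 4 * 2 = pi / 2 :> R by field.
by rewrite /expi cos_pihalf sin_pihalf -complexiE.
Qed.

Lemma expi_pi4_4 : zeta ^+ 4 = -1.
Proof. by rewrite (exprM _ 2 2) expi_pi4_2 sqrCi. Qed.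

Variables (m n : nat) (G : 'M['F_2]_(m, n)) (p : 'rV['F_2]_m -> 'F_2).

Hypothesis G_even : G *m G^T = 0.

(** Evenness of the overlaps makes this half exact; its parity is the sign that T creates for the
    pair z, a. *)
Let half_overlap (z a : 'rV['F_2]_m) := (wt (hadamard (z *m G) (a *m G)))./2.

Lemma overlap_even z a : wt (hadamard (z *m G) (a *m G)) = (half_overlap z a).*2.
Proof.
apply: wt_even; transitivity ((z *m G *m (a *m G)^T) 0 0).
  by rewrite mxE; apply: eq_bigr => j _; rewrite !mxE.
by rewrite trmx_mul mulmxA -(mulmxA z) G_even mulmx0 mul0mx mxE.
Qed.

(** The right side is the third difference of [p] at 0 without the term p(0); taking u = v = w = 0
    forces p(0) = 0. *)
Hypothesis p_polar : forall u v w,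
  \sum_j (u *m G) 0 j * (v *m G) 0 j * (w *m G) 0 j =
  p (u + v + w) - p (u + v) - p (u + w) - p (v + w) + p u + p v + p w.

(** The exponent of -1 by which the phase at z + a differs from the product of the phases at z and
    a. *)
Let B a z : 'F_2 := (half_overlap z a)%:R + (p (z + a) - p z - p a).

(** Mod 2, both summands of [B] fail to be additive by the triple overlap of z, w and a: the half
    overlap by halving [wtD], the second difference of [p] by [p_polar]. The two defects cancel. *)
Lemma polar_form_additive a : {morph B a : z w / z + w}.
Proof.
move=> z w; pose t := wt (hadamard (hadamard (z *m G) (a *m G)) (hadamard (w *m G) (a *m G))).
have ht : (half_overlap (z + w) a + t = half_overlap z a + half_overlap w a)%N.
  apply: double_inj; rewrite !doubleD -!overlap_even -wtD mul2n; congr (wt _ + _)%N.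
  by apply/rowP=> j; rewrite mulmxDl !mxE mulrDl.
have tE : t%:R = \sum_j (z *m G) 0 j * (w *m G) 0 j * (a *m G) 0 j :> 'F_2.
  rewrite wt_natr; apply: eq_bigr => j _.
  rewrite [LHS]mxE 2![hadamard _ _ _ _]mxE.
  by case: (F2_cases ((a *m G) 0 j)) => ->; rewrite ?mulr0 ?mulr1.
have combine (A : comPzRingType) (h hz hw pzwa pzw pza pwa pz pw pa : A) :
    h + (pzwa - pzw - pza - pwa + pz + pw + pa) = hz + hw ->
    h + (pzwa - pzw - pa) = hz + (pza - pz - pa) + (hw + (pwa - pw - pa)).
  by move=> hE; apply/eqP; rewrite addrACA -hE; apply/eqP; ring.
apply: combine; rewrite -p_polar -tE -!natrD.
by congr (_%:R); exact: ht.
Qed.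

(** The criterion [diagop_clifford] applies because [B a], being additive, is the dot product with a
    fixed vector. *)
Lemma T_phase_clifford :
  is_clifford (diagop (fun z => expi (pi / 4 * (wt (z *m G))%:R) * (-1) ^+ p z : R[i])).
Proof.
apply: diagop_clifford => [z|a].
  have hadK : hadamard (z *m G) (z *m G) = z *m G.
    apply/rowP=> j; rewrite [LHS]mxE.
    by case: (F2_cases ((z *m G) 0 j)) => ->; rewrite ?mulr0 ?mulr1.
  (* The weight of [z *m G] is twice [half_overlap z z], so [zeta] enters through its square ['i],
     and each sign counts as ['i ^+ 2]. *)
  exists (half_overlap z z + 2 * p z)%N.
  rewrite expi_natr -[z *m G in LHS]hadK overlap_even -muln2 mulnC.
  by rewrite !exprM exprD exprM expi_pi4_2 sqrCi.
exists (\row_i B a (delta_mx 0 i)) => z.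
have -> : ((\row_i B a (delta_mx 0 i)) *m z^T) 0 0 = B a z.
  rewrite mxE (additive_F2_delta (polar_form_additive a) z).
  by apply: eq_bigr => i _; rewrite !mxE mulrC.
have -> : p (z + a) = (half_overlap z a)%:R + B a z + p z + p a.
  by rewrite /B addrA -natrD addnn natr_F2_odd odd_double add0r addrAC subrK subrK.
have zeta_wtD : expi (pi / 4 * (wt ((z + a) *m G))%:R) * (-1) ^+ half_overlap z a =
    expi (pi / 4 * (wt (z *m G))%:R) * expi (pi / 4 * (wt (a *m G))%:R) :> R[i].
  rewrite !expi_natr -exprD -wtD exprD overlap_even -mul2n mulnA exprM.
  by rewrite expi_pi4_4 -mulmxDl.
have signE : (-1) ^+ ((half_overlap z a)%:R : 'F_2) = (-1) ^+ half_overlap z a :> R[i].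
  by rewrite natr_F2_odd -[RHS]signr_odd; case: (odd _).
have combine (A : comPzRingType) (e h x y b q q' : A) :
    e * h = x * y -> e * (h * b * q * q') = x * q * (y * q') * b.
  by move=> ehE; rewrite -!mulrA mulrA ehE; ring.
by rewrite !exprN1_F2D signE; exact: combine.
Qed.

End TGatePhases.

(** * Binary matrices given by their columns *)

Definition row_bits m (u : 'rV['F_2]_m) : bitseq := [seq u 0 i != 0 | i <- enum 'I_m].

Definition col_bits m n (G : 'M['F_2]_(m, n)) j : bitseq := row_bits (col j G)^T.

Fixpoint bits_dot (s t : bitseq) : bool :=
  match s, t with
  | b :: s', c :: t' => (b && c) (+) bits_dot s' t'
  | _, _ => false
  end.

Lemma F2_natr_neq0 (x : 'F_2) : (x != 0)%:R = x.
Proof. by case: (F2_cases x) => ->. Qed.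

Lemma size_row_bits m (u : 'rV['F_2]_m) : size (row_bits u) = m.
Proof. by rewrite size_map size_enum_ord. Qed.

Lemma nth_row_bits m (u : 'rV['F_2]_m) (i : 'I_m) : (nth false (row_bits u) i)%:R = u 0 i.
Proof. by rewrite (nth_map i) ?size_enum_ord // nth_ord_enum F2_natr_neq0. Qed.

Lemma nth_col_bits m n (G : 'M['F_2]_(m, n)) (i : 'I_m) j :
  (nth false (col_bits G j) i)%:R = G i j.
Proof. by rewrite nth_row_bits !mxE. Qed.

Lemma nth_col_bits_neq0 m n (G : 'M['F_2]_(m, n)) (i : 'I_m) j :
  nth false (col_bits G j) i = (G i j != 0).
Proof. by rewrite -nth_col_bits natr_F2_eq0 negbK oddb. Qed.

Lemma F2_natrM (b c : bool) : b%:R * c%:R = (b && c)%:R :> 'F_2.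
Proof. by case: b c => [] []; rewrite ?mulr0 ?mul0r ?mulr1. Qed.

Lemma F2_natrD (b c : bool) : b%:R + c%:R = (b (+) c)%:R :> 'F_2.
Proof. by rewrite -natrD natr_F2_odd oddD !oddb. Qed.

Lemma bits_dotE m (s t : bitseq) : size s = m -> size t = m ->
  (bits_dot s t)%:R = \sum_(i < m) (nth false s i)%:R * (nth false t i)%:R :> 'F_2.
Proof.
elim: s t m => [|b s IHs] [|c t] [|m] //=; first by rewrite big_ord0.
by move=> [/IHs IH] [/IH{}IH]; rewrite big_ord_recl /= F2_natrM -IH F2_natrD.
Qed.

Section BinaryColumns.

Variables (m n : nat) (G : 'M['F_2]_(m, n)) (cols : seq bitseq).
(** The enumeration of the points gives no explicit column order, so columns are compared up to
    permutation; the properties below depend only on their multiset. *)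
Hypothesis colsE : perm_eq [seq col_bits G j | j <- enum 'I_n] cols.

Lemma sum_col_bits (f : pred bitseq) :
  \sum_j (f (col_bits G j))%:R = (odd (count f cols))%:R :> 'F_2.
Proof.
rewrite -natr_F2_odd -natr_sum; congr _%:R.
by rewrite -sum1_count -(perm_big _ colsE) big_map big_enum_cond /= [RHS]big_mkcond.
Qed.

Lemma mulmx_tr_col_bits (i k : 'I_m) :
  (G *m G^T) i k = (odd (count (fun w => nth false w i && nth false w k) cols))%:R.
Proof.
rewrite mxE -sum_col_bits; apply: eq_bigr => j _.
by rewrite mxE -!nth_col_bits F2_natrM.
Qed.

(** Exhaustive test: every nonzero combination of rows takes the value 1 in some column. *)
Lemma row_free_col_bits :
  all (fun s => has id s ==> has (bits_dot s) cols) (bits m) -> row_free G.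
Proof.
move=> /allP check; apply: inj_row_free => v vG0.
have /implyP v0 : has id (row_bits v) ==> has (bits_dot (row_bits v)) cols.
  by apply: check; rewrite mem_bits size_row_bits.
apply/rowP=> i; rewrite mxE -nth_row_bits; case nth_i: nth => //.
have [|w] := hasP (v0 _).
  by apply/(has_nthP false); exists i; rewrite ?size_row_bits.
rewrite -(perm_mem colsE) => /mapP[j _ ->] dot1.
have := congr1 (fun u : 'rV_n => u 0 j) vG0; rewrite !mxE => vGj0.
have := bits_dotE (size_row_bits v) (size_row_bits (col j G)^T).
under eq_bigr do rewrite nth_row_bits nth_col_bits.
by rewrite vGj0 dot1 => /eqP.
Qed.

Lemma col_bits_inj k :
  uniq [seq drop k w | w <- cols] -> injective (fun j => drop k (col_bits G j)).
Proof.
rewrite -(perm_uniq (perm_map _ colsE)) -map_comp => /dinjectiveP inj i j.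
exact: inj.
Qed.

End BinaryColumns.

(** * Lower bound on the Z-distance *)

Section ZDistance.

Variables (k s n : nat) (G : 'M['F_2]_(k + s.+1, n)) (cols : seq bitseq).
Hypothesis colsE : perm_eq [seq col_bits G j | j <- enum 'I_n] cols.

(* Orthogonality to the all-ones stabilizer makes the weight even, and a vector of weight 2
   is orthogonal to the stabilizers only if the two columns agree on the stabilizer rows. *)
Lemma Zlogical_wt_ge4 v :
    all (fun w => nth false w k) cols -> uniq [seq drop k w | w <- cols] ->
  Zlogical G v -> (4 <= wt v)%N.
Proof.
move=> /allP ones uniq_stab /andP[/eqP Dv0 Uv_neq0].
have Dv i : \sum_j G (rshift k i) j * v 0 j = 0.
  have := congr1 (fun u : 'cV_s.+1 => u i 0) Dv0; rewrite !mxE => {2}<-.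
  by apply: eq_bigr => j _; rewrite !mxE.
have even_v : wt v = (wt v)./2.*2.
  (* Stabilizer index 0 is row [k], the all-ones row, so its orthogonality relation is the sum of
     the entries of [v]. *)
  apply: wt_even; rewrite -[RHS](Dv ord0); apply: eq_bigr => j _.
  have := nth_col_bits G (rshift k ord0) j; rewrite /= addn0 ones; first by move<-; rewrite mul1r.
  by rewrite -(perm_mem colsE) map_f ?mem_enum.
have supp0 : wt v != 0%N.
  apply: contraNneq Uv_neq0 => /eqP; rewrite cards_eq0 => /eqP v0.
  suff -> : v = 0 by rewrite trmx0 mulmx0.
  apply/rowP=> j; apply/eqP; rewrite mxE -[_ == _]negbK; apply/negP=> vj.
  by have := in_set0 j; rewrite -v0 inE vj.
have supp2 : wt v != 2%N.
  apply/negP=> /cards2P[j1 [j2 [/eqP neq_j supp]]]; apply: (neq_j).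
  have v1 j : v 0 j = ((j == j1) || (j == j2))%:R.
    by rewrite -[LHS]F2_natr_neq0 -in_set2 -supp inE.
  apply: (col_bits_inj colsE uniq_stab); apply: (@eq_from_nth _ false).
    by rewrite !size_drop !size_row_bits.
  have -> : size (drop k (col_bits G j1)) = s.+1 by rewrite size_drop size_row_bits addKn.
  move=> i lti.
  have := Dv (Ordinal lti).
  have -> : \sum_j G (rshift k (Ordinal lti)) j * v 0 j =
      \sum_(j in [set j1; j2]) G (rshift k (Ordinal lti)) j.
    rewrite [RHS]big_mkcond; apply: eq_bigr => j _.
    by rewrite v1 in_set2; case: ifP; rewrite ?mulr1 ?mulr0.
  rewrite big_setU1 ?big_set1 ?in_set1 ?(introN eqP neq_j) //.
  have F2_addr_eq0 (x y : 'F_2) : x + y = 0 -> x = y.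
    by case: (F2_cases x) => ->; case: (F2_cases y) => ->.
  move=> /F2_addr_eq0 Gj12; rewrite !nth_drop.
  by rewrite -[(k + i)%N]/(rshift k (Ordinal lti) : nat) !nth_col_bits_neq0 Gj12.
by rewrite even_v; case: (wt v)./2 even_v supp0 supp2 => [|[|h]] -> //.
Qed.

End ZDistance.

(** * The columns of the Hermitian matrix *)

Definition F16_exp := bits_exp 4 F16_red.

Definition tr_beta_bits i (u : bitseq) : bool :=
  bits_trace 4 F16_red
    (bits_mul 4 F16_red (F16_exp [:: false; true; false; false] (nth 0 [:: 3; 12; 7; 13] i)%N) u).

Definition hermitian_points : seq (bitseq * bitseq) :=
  [seq c <- [seq (s, t) | s <- bits 4, t <- bits 4] |
     bits_add (F16_exp c.2 4) c.2 == F16_exp c.1 5].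

(** The bits follow the row order of [hermitian_mx]: six logical rows, the row 1 at position 6, then
    the traces of x and y. *)
Definition hermitian_col (c : bitseq * bitseq) : bitseq :=
  let xy := bits_mul 4 F16_red c.1 c.2 in
  [seq tr_beta_bits i (F16_exp c.1 3) | i <- [:: 2; 3]%N]
  ++ [seq tr_beta_bits i xy | i <- iota 0 4]
  ++ true :: [seq tr_beta_bits i c.1 | i <- iota 0 4]
  ++ [seq tr_beta_bits i c.2 | i <- iota 0 4].

Definition hermitian_cols : seq bitseq := [seq hermitian_col c | c <- hermitian_points].

(* The logical qubits carry (x_1, x_2, y_2, y_1, z_1, z_2) in the notation of F4_CCZ. *)
Definition CCZ_monomials : seq (nat * nat * nat) :=
  [:: (0, 3, 5); (0, 2, 4); (0, 2, 5); (1, 3, 4); (1, 3, 5); (1, 2, 4)]%N.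

Definition matches_monomial (i j k : nat) (t : nat * nat * nat) : nat :=
  (i == t.1.1) && (j == t.1.2) && (k == t.2).

(** The full polarization of the monomial [t] at the basis vectors i, j, k, summed over the six
    orderings. *)
Definition polar_monomial (i j k : nat) t : nat :=
  (matches_monomial i j k t + matches_monomial i k j t + matches_monomial j i k t
  + matches_monomial j k i t + matches_monomial k i j t + matches_monomial k j i t)%N.

Lemma size_hermitian_points : size hermitian_points = 64%N.
Proof. by vm_compute. Qed.

Lemma uniq_hermitian_points : uniq hermitian_points.
Proof. by vm_compute. Qed.

Lemma hermitian_cols_free :
  all (fun s => has id s ==> has (bits_dot s) hermitian_cols) (bits 15).
Proof. by vm_compute. Qed.

Lemma hermitian_cols_one : all (fun w => nth false w 6) hermitian_cols.
Proof. by vm_compute. Qed.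

Lemma uniq_hermitian_stabilizer : uniq [seq drop 6 w | w <- hermitian_cols].
Proof. by vm_compute. Qed.

Lemma hermitian_cols_even :
  all (fun i => all (fun k =>
    ~~ odd (count (fun w => nth false w i && nth false w k) hermitian_cols))
    (iota 0 15)) (iota 0 15).
Proof. by vm_compute. Qed.

(** Repeated indices are included: the left side is then a pairwise overlap or a row weight, and the
    right side vanishes because each monomial has distinct indices. *)
Lemma hermitian_cols_triple :
  all (fun i => all (fun j => all (fun k =>
    odd (count (fun w => nth false w i && nth false w j && nth false w k) hermitian_cols)
    == odd (sumn [seq polar_monomial i j k t | t <- CCZ_monomials]))
    (iota 0 15)) (iota 0 15)) (iota 0 15).
Proof. by vm_compute. Qed.

(** Four points of the curve with x-sum 0 and y-sum 0, hence orthogonal to all stabilizers. Their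
    xy-sum is alpha + (alpha + 1) = 1, which some tr(beta_i xy) detects. *)
Definition weight4_cols : seq bitseq :=
  let zero := nseq 4 false in
  let one := bits_one 4 in
  let alpha := [:: false; true; false; false] in
  [seq hermitian_col c |
     c <- [:: (zero, zero); (zero, one); (one, alpha); (one, bits_add alpha one)]].

Definition weight4_parity i : bool :=
  odd (count (fun w => nth false w i && (w \in weight4_cols)) hermitian_cols).

Lemma weight4_cols_Zlogical :
  [&& ~~ has weight4_parity (iota 6 9), has weight4_parity (iota 0 6) &
      count (mem weight4_cols) hermitian_cols == 4%N].
Proof. by vm_compute. Qed.

(** * From bit codes to the points of the curve and the columns of the matrix *)

Section HermitianColumns.

Variables (F16 : finFieldType) (alpha : F16).
Hypotheses (card_F16 : #|F16| = 16%N) (alphaE : alpha ^+ 4 = alpha + 1).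

Let ev : bitseq -> F16 := bits_eval alpha.
Let ev2 (c : bitseq * bitseq) : F16 * F16 := (ev c.1, ev c.2).

Let alpha4 : alpha ^+ 4 = bits_eval alpha F16_red.
Proof. by rewrite alphaE /= !(mulr0, mulr1, addr0, add0r) addrC. Qed.

Let card16 : #|F16| = (2 ^ 4)%N := card_F16.

Lemma pchar_F16 : 2%N \in [pchar F16].
Proof. exact: (bits_pchar bits_field16 card16). Qed.

Lemma ev_alpha : ev [:: false; true; false; false] = alpha.
Proof. by rewrite /ev /= !(mulr0, mulr1, addr0, add0r). Qed.

Lemma tr_beta_ev i u : (i < 4)%N -> size u = 4%N ->
  tr_beta alpha i (ev u) = (tr_beta_bits i u)%:R.
Proof.
move=> lti sz; rewrite -(traceF2_bits_eval bits_field16 card16 alpha4).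
rewrite (bits_eval_mul bits_field16 card16 alpha4) //.
rewrite (bits_eval_exp bits_field16 card16 alpha4) -/ev ev_alpha.
by case: i lti => [|[|[|[|]]]].
Qed.

Lemma hermitian_points_size c :
  c \in hermitian_points -> size c.1 = 4%N /\ size c.2 = 4%N.
Proof.
rewrite mem_filter => /andP[_ /allpairsP[p [+ + ->]]].
by rewrite !mem_bits => /eqP szs /eqP szt.
Qed.

Lemma ev_exp s k : ev (F16_exp s k) = ev s ^+ k.
Proof. exact: (bits_eval_exp bits_field16 card16 alpha4). Qed.

Lemma ev_inj s t : size s = 4%N -> size t = 4%N -> ev s = ev t -> s = t.
Proof. exact: (bits_eval_inj bits_field16 card16 alpha4). Qed.

Lemma size_F16_exp s k : size (F16_exp s k) = 4%N.
Proof. exact: (size_bits_exp bits_field16). Qed.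

Lemma ev_points s t : size s = 4%N -> size t = 4%N ->
  (ev2 (s, t) \in points F16) = ((s, t) \in hermitian_points).
Proof.
move=> szs szt; rewrite inE mem_filter /= -!ev_exp -(bits_eval_add _ bits_field16 card16).
have -> : (s, t) \in [seq (s0, t0) | s0 <- bits 4, t0 <- bits 4].
  by apply/allpairsP; exists (s, t); rewrite !mem_bits szs szt.
rewrite andbT; apply/eqP/eqP => [|->//].
by apply: ev_inj; rewrite ?size_bits_add ?size_F16_exp ?szt.
Qed.

(** Evaluation is a bijection from codes of length 4 to the field, so the filtered codes meet each
    point of the curve exactly once. *)
Lemma perm_points : perm_eq (enum (points F16)) [seq ev2 c | c <- hermitian_points].
Proof.
apply: uniq_perm; rewrite ?enum_uniq ?map_inj_in_uniq ?uniq_hermitian_points //.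
  move=> [s t] [s' t'] /hermitian_points_size[/= szs szt] /hermitian_points_size[/= szs' szt'].
  by case=> /ev_inj-> // /ev_inj->.
move=> [x y]; rewrite mem_enum.
have [s + ->] := bits_eval_surj bits_field16 card16 alpha4 x.
have [t + ->] := bits_eval_surj bits_field16 card16 alpha4 y.
rewrite !mem_bits => /eqP szt /eqP szs.
rewrite -[(_, _)]/(ev2 (s, t)) ev_points //; apply/idP/mapP => [st_in|[[s' t'] c_in]].
  by exists (s, t).
have [/= szs' szt'] := hermitian_points_size c_in.
by case=> /ev_inj-> // /ev_inj->.
Qed.

Lemma card_points : #|points F16| = 64%N.
Proof. by rewrite cardE (perm_size perm_points) size_map size_hermitian_points. Qed.

Lemma hermitian_col_ev c : c \in hermitian_points ->
  [seq f (ev2 c) != 0 | f <- logical_fun alpha ++ stabilizer_fun alpha] = hermitian_col c.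
Proof.
case: c => s t /hermitian_points_size[/= szs szt].
rewrite -!ev_exp -(bits_eval_mul bits_field16 card16 alpha4) // -/ev.
by rewrite !tr_beta_ev ?size_F16_exp ?(size_bits_mul bits_field16) // !natr_F2_eq0 !negbK !oddb.
Qed.

Lemma col_bits_hermitian j :
  col_bits (hermitian_mx alpha) j =
  [seq f (enum_val j) != 0 | f <- logical_fun alpha ++ stabilizer_fun alpha].
Proof.
apply: (@eq_from_nth _ false) => [|i]; rewrite size_row_bits // => lti.
have -> : i = Ordinal lti by []; rewrite nth_col_bits_neq0.
rewrite (nth_map (fun=> 0)) // nth_cat size_tuple mxE.
case: splitP => k /= ->; rewrite mxE (tnth_nth (fun=> 0)) //.
by have -> : (6 + k - 6 = k)%N by rewrite addKn.
Qed.

Lemma perm_hermitian_cols :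
  perm_eq [seq col_bits (hermitian_mx alpha) j | j <- enum 'I_#|points F16|] hermitian_cols.
Proof.
pose g p := [seq f p != 0 | f <- logical_fun alpha ++ stabilizer_fun alpha].
have enumE : [seq enum_val j | j <- enum 'I_#|points F16|] = enum (points F16).
  apply: (@eq_from_nth _ (0, 0)); rewrite size_map size_enum_ord ?cardE // => i lti.
  have lti' : (i < #|points F16|)%N by move: lti; rewrite -?cardE.
  rewrite (nth_map (Ordinal lti')) ?size_enum_ord // (enum_val_nth (0, 0)).
  by rewrite nth_enum_ord.
rewrite (eq_map (col_bits_hermitian : _ =1 g \o enum_val)) map_comp enumE.
apply: (perm_trans (perm_map g perm_points)).
rewrite -map_comp -(_ : hermitian_cols = map _ _); first exact: perm_refl.
by apply/eq_in_map=> c /hermitian_col_ev <-.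
Qed.

End HermitianColumns.

(** * Self-dual basis and cubic forms *)

Section SelfDualBeta.

Variables (F16 : finFieldType) (alpha : F16).
Hypotheses (card_F16 : #|F16| = 16%N) (alphaE : alpha ^+ 4 = alpha + 1).

Lemma beta_dual (i j : 'I_4) :
  traceF2 (tnth (beta alpha) i * tnth (beta alpha) j) = (i == j)%:R.
Proof.
have betaE : tnth (beta alpha) j =
    bits_eval alpha (F16_exp [:: false; true; false; false] (nth 0 [:: 3; 12; 7; 13] j)%N).
  rewrite (ev_exp card_F16 alphaE) ev_alpha (tnth_nth 0).
  by case: j => [[|[|[|[|]]]]].
rewrite betaE (tnth_nth 0) -/(tr_beta alpha i _).
rewrite (tr_beta_ev card_F16 alphaE) ?size_F16_exp //; congr (nat_of_bool _)%:R.
by case: i j {betaE} => [[|[|[|[|]]]] //] + [[|[|[|[|]]]] //] /=; vm_compute.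
Qed.

Lemma beta_self_dual : self_dual_basis (beta alpha).
Proof.
split=> [|i j]; last exact: beta_dual.
pose f (c : 'rV['F_2]_4) : F16 := \sum_(i < 4) (c 0 i)%:R * tnth (beta alpha) i.
have trD := traceF2D (pchar_F16 card_F16).
have tr0 : traceF2 (0 : F16) = 0.
  by have := trD 0 0; rewrite addr0; case: (F2_cases (traceF2 (0 : F16))) => -> // /eqP.
(* Self-duality makes the trace against the j-th basis element read off the j-th coordinate. *)
have fK c j : traceF2 (tnth (beta alpha) j * f c) = c 0 j.
  rewrite big_distrr (big_morph _ trD tr0) (bigD1 j) //= big1 ?addr0 => [|i neq_ij].
    case: (F2_cases (c 0 j)) => ->; rewrite ?mul0r ?mulr0 // mul1r beta_dual.
    by rewrite eqxx.
  case: (F2_cases (c 0 i)) => ->; rewrite ?mul0r ?mulr0 // mul1r beta_dual.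
  by rewrite eq_sym (negbTE neq_ij).
have inj_f : injective f.
  by move=> c c' eq_f; apply/rowP=> j; rewrite -fK eq_f fK.
(* Both sides have 16 elements, so injectivity gives existence and uniqueness of the expansion. *)
have [|g gK fgK] := inj_card_bij inj_f; first by rewrite card_F16 card_mx card_Fp.
by move=> x; exists (g x); split=> [|c ->]; [exact: esym (fgK x) | exact: gK].
Qed.

End SelfDualBeta.

(** * Cubic forms over F_2 and their polarization *)

Section CubicForms.

Variables (m : nat) (s : seq ('I_m * 'I_m * 'I_m)).

Definition cubic_form (z : 'rV['F_2]_m) : 'F_2 :=
  \sum_(t <- s) z 0 t.1.1 * z 0 t.1.2 * z 0 t.2.

Definition polar_form (u v w : 'rV['F_2]_m) : 'F_2 :=
  \sum_(t <- s) (u 0 t.1.1 * v 0 t.1.2 * w 0 t.2 + u 0 t.1.1 * w 0 t.1.2 * v 0 t.2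
    + v 0 t.1.1 * u 0 t.1.2 * w 0 t.2 + v 0 t.1.1 * w 0 t.1.2 * u 0 t.2
    + w 0 t.1.1 * u 0 t.1.2 * v 0 t.2 + w 0 t.1.1 * v 0 t.1.2 * u 0 t.2).

(** Inclusion-exclusion, monomial by monomial: only the products using each of u, v, w once
    survive. *)
Lemma cubic_form_polar u v w :
  polar_form u v w = cubic_form (u + v + w) - cubic_form (u + v) - cubic_form (u + w)
    - cubic_form (v + w) + cubic_form u + cubic_form v + cubic_form w.
Proof.
rewrite /cubic_form -!sumrB -!big_split; apply: eq_bigr => t _; rewrite /= !mxE.
have expand (A : comPzRingType) (a b c a' b' c' a'' b'' c'' : A) :
    a * b' * c'' + a * b'' * c' + a' * b * c'' + a' * b'' * c + a'' * b * c' + a'' * b' * c =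
    (a + a' + a'') * (b + b' + b'') * (c + c' + c'') - (a + a') * (b + b') * (c + c')
    - (a + a'') * (b + b'') * (c + c'') - (a' + a'') * (b' + b'') * (c' + c'')
    + a * b * c + a' * b' * c' + a'' * b'' * c'' by ring.
exact: expand.
Qed.

Lemma polar_formD v w : {morph polar_form^~ v ^~ w : u u' / u + u'}.
Proof.
move=> u u'; rewrite /polar_form -big_split; apply: eq_bigr => t _; rewrite /= !mxE.
have expand (A : comPzRingType) (x1 x2 x3 y1 y2 y3 v1 v2 v3 w1 w2 w3 : A) :
    (x1 + y1) * v2 * w3 + (x1 + y1) * w2 * v3 + v1 * (x2 + y2) * w3 + v1 * w2 * (x3 + y3)
      + w1 * (x2 + y2) * v3 + w1 * v2 * (x3 + y3) =
    x1 * v2 * w3 + x1 * w2 * v3 + v1 * x2 * w3 + v1 * w2 * x3 + w1 * x2 * v3 + w1 * v2 * x3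
    + (y1 * v2 * w3 + y1 * w2 * v3 + v1 * y2 * w3 + v1 * w2 * y3 + w1 * y2 * v3 + w1 * v2 * y3)
  by ring.
exact: expand.
Qed.

Lemma polar_formC u v w : polar_form u v w = polar_form v u w.
Proof. by apply: eq_bigr => t _; rewrite [LHS](AC 6 (3*4*1*2*6*5)). Qed.

Lemma polar_formAC u v w : polar_form u v w = polar_form w v u.
Proof. by apply: eq_bigr => t _; rewrite [LHS](AC 6 (6*5*4*3*2*1)). Qed.

End CubicForms.

Definition CCZ_qubit_monomials m : seq ('I_(6 + m) * 'I_(6 + m) * 'I_(6 + m)) :=
  [seq (lshift m (inord t.1.1), lshift m (inord t.1.2), lshift m (inord t.2))
     | t <- CCZ_monomials].

Lemma polar_form_CCZ_delta (i j k : 'I_(6 + 9)) :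
  polar_form (CCZ_qubit_monomials 9) (delta_mx 0 i) (delta_mx 0 j) (delta_mx 0 k) =
  (odd (sumn [seq polar_monomial i j k t | t <- CCZ_monomials]))%:R.
Proof.
have deltaE (l : 'I_(6 + 9)) a : (a < 6)%N ->
    (delta_mx 0 l : 'rV['F_2]_(6 + 9)) 0 (lshift 9 (inord a : 'I_6)) = (l == a :> nat)%:R.
  by move=> lta; rewrite mxE eqxx eq_sym -val_eqE /= inordK.
rewrite -natr_F2_odd /polar_form big_map sumnE big_map natr_sum.
have lt6 : all (fun t => [&& t.1.1 < 6, t.1.2 < 6 & t.2 < 6])%N CCZ_monomials by [].
apply: eq_big_seq => t /(allP lt6)/and3P[lt1 lt2 lt3] /=.
by rewrite !deltaE // /polar_monomial /matches_monomial -!natrM !mulnb -!natrD.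
Qed.

(** * Pairwise and triple overlaps of the Hermitian matrix *)

Section HermitianPhases.

Variables (F16 : finFieldType) (alpha : F16).
Hypotheses (card_F16 : #|F16| = 16%N) (alphaE : alpha ^+ 4 = alpha + 1).

Let G := hermitian_mx alpha.
Let colsE : perm_eq [seq col_bits G j | j <- enum 'I_#|points F16|] hermitian_cols.
Proof. exact: perm_hermitian_cols. Qed.

Lemma hermitian_mx_even : G *m G^T = 0.
Proof.
apply/matrixP=> i k; rewrite (mulmx_tr_col_bits colsE) [RHS]mxE.
have /allP/(_ (i : nat)) := hermitian_cols_even; rewrite mem_iota ltn_ord => /(_ isT).
move=> /allP/(_ (k : nat)); rewrite mem_iota ltn_ord => /(_ isT).
by case: (odd _).
Qed.

Let triple (u v w : 'rV['F_2]_(6 + 9)) : 'F_2 :=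
  \sum_j (u *m G) 0 j * (v *m G) 0 j * (w *m G) 0 j.

(** Both sides are symmetric and trilinear, so they need only be compared on basis vectors, where
    [hermitian_cols_triple] decides. *)
Lemma triple_hermitian u v w : triple u v w = polar_form (CCZ_qubit_monomials 9) u v w.
Proof.
have tripleD v' w' : {morph triple^~ v' ^~ w' : x y / x + y}.
  move=> x y; rewrite /triple -big_split; apply: eq_bigr => j _.
  by rewrite mulmxDl mxE !mulrDl.
have tripleC x y z : triple x y z = triple y x z.
  by apply: eq_bigr => j _; congr (_ * _); rewrite mulrC.
have tripleAC x y z : triple x y z = triple z y x.
  by apply: eq_bigr => j _; rewrite mulrC mulrA mulrAC.
move: u; apply: additive_F2_ext; [exact: tripleD|exact: polar_formD|move=> i].
(* Symmetry brings the next free argument to the first slot, where additivity is stated; the basis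
   indices end up in the order k, i, j. *)
rewrite tripleC polar_formC; move: v.
apply: additive_F2_ext; [exact: tripleD|exact: polar_formD|move=> j].
rewrite tripleAC polar_formAC; move: w.
apply: additive_F2_ext; [exact: tripleD|exact: polar_formD|move=> k].
rewrite polar_form_CCZ_delta /triple.
transitivity (\sum_l (let c := col_bits G l in
    nth false c k && nth false c i && nth false c j)%:R : 'F_2).
  by apply: eq_bigr => l _; rewrite -!rowE 3![row _ _ 0 l]mxE -!F2_natrM !nth_col_bits.
rewrite (sum_col_bits colsE (fun c => nth false c k && nth false c i && nth false c j)).
have /allP/(_ (k : nat)) := hermitian_cols_triple; rewrite mem_iota ltn_ord => /(_ isT).
move=> /allP/(_ (i : nat)); rewrite mem_iota ltn_ord => /(_ isT).
move=> /allP/(_ (j : nat)); rewrite mem_iota ltn_ord => /(_ isT).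
by move=> /eqP ->.
Qed.

End HermitianPhases.

(** * The CCZ gate over F_4 *)

Section F4Phase.

Variables (F4 : finFieldType) (omega : F4).
Hypotheses (card_F4 : #|F4| = 4%N) (omegaE : omega ^+ 2 = omega + 1).

Let card2 : #|F4| = (2 ^ 2)%N := card_F4.

Let omega2 : omega ^+ 2 = bits_eval omega F4_red.
Proof. by rewrite omegaE /= !(mulr0, mulr1, addr0) addrC. Qed.

Lemma traceF2_F4_product (x1 x2 y1 y2 z1 z2 : bool) :
  traceF2 ((x1%:R * omega + x2%:R * omega ^+ 2) * (y1%:R * omega + y2%:R * omega ^+ 2)
           * (z1%:R * omega + z2%:R * omega ^+ 2)) =
  (x1 && (y1 && z2 (+) y2 && z1 (+) y2 && z2)
   (+) x2 && (y1 && z1 (+) y1 && z2 (+) y2 && z1))%:R.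
Proof.
(* Since omega^2 = omega + 1, coordinates (a, b) on omega, omega^2 become (b, a + b) on 1, omega. *)
have eltE (a b : bool) : a%:R * omega + b%:R * omega ^+ 2 =
    bits_eval omega [:: b; a (+) b].
  rewrite omegaE /= !(mulr0, mulr1, addr0); case: a b => [] [] /=;
    rewrite ?(mul0r, mulr0, mul1r, mulr1, add0r, addr0) 1?addrC //.
  by rewrite -addrA [1 + _]addrC addrA (addrr_pchar2 (bits_pchar bits_field4 card2)) add0r.
rewrite !eltE -!(bits_eval_mul bits_field4 card2 omega2) //.
  rewrite (traceF2_bits_eval bits_field4 card2 omega2); congr (nat_of_bool _)%:R.
  by case: x1 x2 y1 y2 z1 z2 => [] [] [] [] [] []; vm_compute.
Qed.

(** The exponent inside [F4_CCZ], kept in the same form so that the gate is [diagop] of its sign by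
    conversion. *)
Definition F4_CCZ_phase (q : 'rV['F_2]_6) : 'F_2 :=
  let elt (i : 'I_3) : F4 :=
    (q 0 (inord i.*2))%:R * omega + (q 0 (inord i.*2.+1))%:R * omega ^+ 2 in
  traceF2 (elt 0 * elt 1 * elt 2).

Lemma F4_CCZ_phase_perm m (z : 'rV['F_2]_(6 + m)) :
  F4_CCZ_phase (col_perm (tperm (inord 2) (inord 3))^-1 (lsubmx z)) =
  cubic_form (CCZ_qubit_monomials m) z.
Proof.
pose b a := z 0 (lshift m (inord a)) != 0.
have zE a : z 0 (lshift m (inord a)) = (b a)%:R by rewrite F2_natr_neq0.
have natF2 (c : bool) : nat_of_ord (c%:R : 'F_2) = c by case: c.
have neqI a c : (a < 6)%N -> (c < 6)%N -> a != c -> (inord a : 'I_6) != inord c.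
  by move=> lta ltc; rewrite -val_eqE /= !inordK.
(* The list swaps positions 2 and 3, because the logical qubits carry y_2 before y_1. *)
have qE a : (a < 6)%N ->
    col_perm (tperm (inord 2) (inord 3))^-1 (lsubmx z) 0 (inord a) =
    (b (nth 0%N [:: 0; 1; 3; 2; 4; 5]%N a))%:R.
  move=> lta; rewrite mxE tpermV -zE mxE; congr (z 0 (lshift m _)).
  case: a lta => [|[|[|[|[|[|]]]]]] //= _; rewrite ?tpermL ?tpermR //;
    by rewrite tpermD //; apply: neqI.
have -> : F4_CCZ_phase (col_perm (tperm (inord 2) (inord 3))^-1 (lsubmx z)) =
  traceF2 (((b 0)%:R * omega + (b 1)%:R * omega ^+ 2)
           * ((b 3)%:R * omega + (b 2)%:R * omega ^+ 2)
           * ((b 4)%:R * omega + (b 5)%:R * omega ^+ 2)).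
  by rewrite /F4_CCZ_phase !qE // !natF2.
rewrite traceF2_F4_product /cubic_form /CCZ_qubit_monomials /= !big_cons big_nil /= !zE.
rewrite addr0 !F2_natrM !F2_natrD; congr (nat_of_bool _)%:R.
by move: (b 0) (b 1) (b 2) (b 3) (b 4) (b 5) => [] [] [] [] [] [].
Qed.

End F4Phase.

Theorem mainTheorem20
    (R : realType)
    (F16 : finFieldType) (card_F16 : #|F16| = 16%N)
    (alpha : F16) (alphaE : alpha ^+ 4 = alpha + 1)
    (F4 : finFieldType) (card_F4 : #|F4| = 4%N)
    (omega : F4) (omegaE : omega ^+ 2 = omega + 1) :
  let G := hermitian_mx alpha in
  [/\ #|points F16| = 64%N,
      self_dual_basis (beta alpha),
      row_free G,
      Zdistance_is G 4
    & exists (C : operator R[i] (6 + 9)) (V : operator R[i] 6) (s : 'S_6),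
      [/\ is_diag_mx C, is_clifford C,
          V = qubit_perm _ s *m F4_CCZ _ omega *m (qubit_perm _ s)^t*
        & T_induced R G = C *m tensop V 1%:M]].
Proof.
move=> G; have colsE := perm_hermitian_cols card_F16 alphaE; rewrite -/G in colsE.
split.
- exact: (card_points card_F16 alphaE).
- exact: beta_self_dual.
- exact: row_free_col_bits colsE hermitian_cols_free.
- split=> [|v]; last first.
    exact: (Zlogical_wt_ge4 colsE hermitian_cols_one uniq_hermitian_stabilizer).
  have /and3P[stab logical wt4] := weight4_cols_Zlogical.
  (* With an indicator vector as witness, the entries of G v are the parities already computed. *)
  pose v : 'rV['F_2]_#|points F16| := \row_j (col_bits G j \in weight4_cols)%:R.
  have GvE i : \sum_j G i j * v 0 j = (weight4_parity i)%:R.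
    rewrite -(sum_col_bits colsE); apply: eq_bigr => j _.
    by rewrite -nth_col_bits mxE F2_natrM.
  exists v; last first.
    rewrite wt_sum -(eqP wt4) -sum1_count -(perm_big _ colsE) big_map big_enum_cond /=.
    rewrite [RHS]big_mkcond; apply: eq_bigr => j _.
    by rewrite mxE natr_F2_eq0 negbK oddb.
  apply/andP; split.
    apply/eqP/colP=> i.
    have nb : ~~ weight4_parity (rshift 6 i).
      by apply: (hasPn stab); rewrite mem_iota leq_addr ltn_add2l ltn_ord.
    rewrite !mxE; transitivity (\sum_j G (rshift 6 i) j * v 0 j).
      by apply: eq_bigr => j _; rewrite !mxE.
    by rewrite GvE (negbTE nb).
  have [k] := hasP logical; rewrite mem_iota => ltk parity_k.
  apply/eqP=> /colP/(_ (Ordinal ltk)); rewrite !mxE => /eqP.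
  have -> : \sum_j usubmx G (Ordinal ltk) j * v^T j 0 =
      \sum_j G (lshift 9 (Ordinal ltk)) j * v 0 j.
    by apply: eq_bigr => j _; rewrite !mxE.
  by rewrite GvE natr_F2_eq0 oddb parity_k.
pose p := cubic_form (CCZ_qubit_monomials 9).
(* The Clifford factor is the T phase divided by the CCZ sign; a sign is its own inverse, so
   multiplying by V restores the T phase. *)
exists (diagop (fun z => expi (pi / 4 * (wt (z *m G))%:R) * (-1) ^+ p z)).
exists (qubit_perm _ (tperm (inord 2) (inord 3)) *m F4_CCZ _ omega
        *m (qubit_perm _ (tperm (inord 2) (inord 3)))^t*).
exists (tperm (inord 2) (inord 3)); split=> //.
- exact: diag_mx_is_diag.
- apply: T_phase_clifford => [|u v w]; first exact: hermitian_mx_even.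
  by rewrite -cubic_form_polar -(triple_hermitian card_F16 alphaE).
- rewrite -[F4_CCZ _ omega]/(diagop (fun q => (-1) ^+ F4_CCZ_phase omega q)).
  rewrite qubit_perm_diagop tensop_diagop1 mul_diagop; apply: eq_diagop => z.
  by rewrite F4_CCZ_phase_perm // -[RHS]mulrA -expr2 sqrr_sign mulr1.
Qed.
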